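(* Let $p\ge 1$, let $\mathcal M$ be a non-empty collection of subsets of $\Lambda^{(N)}$, let $\mathrm{pen}:\mathcal M\to\mathbb R_+$ be any function, and let $\tilde\theta=\hat\theta^{(\hat m)}$ be the PCO estimator in the sequence model $Y_\lambda=\theta_\lambda+\varepsilon\xi_\lambda$, $\lambda\in\Lambda$. If $p>1$, then for any $m\in\mathcal M$ and any $\alpha\in(0,2)$, $$\|\tilde\theta-\theta\|_p^p\le M_{p,\alpha}\|\hat\theta^{(m)}-\theta\|_p^p+\frac2\alpha\Big[(1+\alpha)V_p(\hat m)-\mathrm{pen}(\hat m)\Big]-\frac2\alpha\Big[(1+\alpha)V_p(m)-\mathrm{pen}(m)\Big],$$ where $M_{p,\alpha}$ depends only on $p$ and $\alpha$. In particular, with $\alpha=1$, $$\|\tilde\theta-\theta\|_p^p\le M_{p}\|\hat\theta^{(m)}-\theta\|_p^p+2\Big[2V_p(\hat m)-\mathrm{pen}(\hat m)\Big]-2\Big[2V_p(m)-\mathrm{pen}(m)\Big],$$ where $M_p=M_{p,1}$ and one can take $$M_{p,\alpha}=\frac2\alpha\Big(1+\max\big(C(\tfrac\alpha2,p)-1,\ C_{2p}(\alpha,K_{p,\alpha}^{-1})\big)\Big).$$ If $p=1$, then for any $m\in\mathcal M$ and any $\alpha\in(0,2)$ the first inequality holds (with a constant $M_{1,\alpha}$ depending only on $\alpha$) with $\frac2\alpha$ replaced by $\frac1{\alpha\wedge1}$ in front of both brackets on the right-hand side.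
   Context: Model: $\Lambda$ is a countable set, $\Lambda^{(N)}$ is the set of its first $N$ elements, $0<\varepsilon\le 1$, $\theta=(\theta_\lambda)_{\lambda\in\Lambda}$ is an unknown real sequence, and $Y_\lambda=\theta_\lambda+\varepsilon\xi_\lambda$, where the $\xi_\lambda$ are i.i.d. centered real random variables with $\mathbb P(|\xi_\lambda|\ge t)\le 2e^{-t^2/2}$ for all $t\ge0$. Norm: $w=(w_\lambda)_{\lambda\in\Lambda}$ are non-negative weights and $\|\vartheta\|_p^p=\sum_{\lambda\in\Lambda}w_\lambda|\vartheta_\lambda|^p$. It is assumed that $\|\theta\|_p<\infty$. Estimators: for $m\subset\Lambda^{(N)}$, $\hat\theta^{(m)}=(Y_\lambda\mathbf 1_{\{\lambda\in m\}})_{\lambda\in\Lambda}$ and $V_p(m)=\varepsilon^p\sum_{\lambda\in m}w_\lambda|\xi_\lambda|^p$. The PCO estimator is $\tilde\theta=\hat\theta^{(\hat m)}$, where $\hat m$ is a minimizer over $m\in\mathcal M$ of $-\sum_{\lambda\in m}w_\lambda|Y_\lambda|^p+\mathrm{pen}(m)$. Constants: for $\alpha,K>0$ and $p\ge 1$, $C_{1p}(\alpha,K)=\max_{|x|\le K^{-1}}\big||1+x|^p-1-\alpha|x|^p\big|$ and $C_{2p}(\alpha,K)=\max_{|x|\le K^{-1}}\big||1+x|^p-\alpha-|x|^p\big|$. For $p>1$, $C(\alpha,p)=\big(1-(1+\alpha)^{-1/(p-1)}\big)^{-(p-1)}$. For $\alpha\in(0,2)$, $K_{p,\alpha}>0$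 is a number (depending only on $p,\alpha$) such that $C_{1p}(\alpha,K_{p,\alpha})\le1-\alpha/2$. *)

(* Defs.v *)
From HB Require Import structures.
From mathcomp Require Import all_boot all_order all_algebra.
From mathcomp Require Import finmap.
From mathcomp Require Import all_classical all_reals all_analysis.

Set Implicit Arguments.
Unset Strict Implicit.
Unset Printing Implicit Defensive.

Import Order.TTheory GRing.Theory Num.Theory.
Import numFieldNormedType.Exports.

Local Open Scope classical_set_scope.
Local Open Scope ring_scope.

Section Constants.
Context {R : realType}.

(* The functions of [x] below are continuous, so that these suprema over the
   compact set |x| <= 1/K are maxima. *)
Definition C1 (p alpha K : R) : R :=
  sup [set `| `|1 + x| `^ p - 1 - alpha * `|x| `^ p | | x in
       [set x : R | `|x| <= K^-1]].

Definition C2 (p alpha K : R) : R :=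
  sup [set `| `|1 + x| `^ p - alpha - `|x| `^ p | | x in
       [set x : R | `|x| <= K^-1]].

Definition Cconv (alpha p : R) : R :=
  (1 - (1 + alpha) `^ (- (p - 1)^-1)) `^ (- (p - 1)).

Definition admissible_K (K : R -> R -> R) : Prop :=
  forall p alpha : R, 1 <= p -> 0 < alpha < 2 ->
    0 < K p alpha /\ C1 p alpha (K p alpha) <= 1 - alpha / 2.

End Constants.

Section Noise.
Context {R : realType} {d : measure_display} {T : measurableType d}.
Context (P : probability T R) {L : choiceType}.

Definition mutually_independent (xi : L -> {RV P >-> R}) : Prop :=
  forall (J : {fset L}) (A : L -> set R), (forall l, measurable (A l)) ->
    P [set om | forall l, l \in J -> A l (xi l om)] =
    (\prod_(l <- J) P (xi l @^-1` A l))%E.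

Definition identically_distributed (xi : L -> {RV P >-> R}) : Prop :=
  forall (l l' : L) (A : set R), measurable A ->
    distribution P (xi l) A = distribution P (xi l') A.

Definition centered (X : {RV P >-> R}) : Prop :=
  P.-integrable setT (EFin \o X) /\ ('E_P[X] = 0)%E.

Definition subgaussian_tail (X : {RV P >-> R}) : Prop :=
  forall t : R, 0 <= t ->
    (P [set om | (t <= `|X om|)%R] <= (2 * expR (- (t ^+ 2 / 2)))%:E)%E.

End Noise.

Section SequenceModel.
Context {R : realType} {L : countType}.

(* [rank] numbers the elements of [L] from 0 without gaps: its image is an
   initial segment of nat, all of nat when [L] is infinite. *)
Definition is_enumeration (rank : L -> nat) : Prop :=
  injective rank /\
  forall (l : L) (k : nat), (k < rank l)%N -> exists l' : L, rank l' = k.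

Definition first_elements (rank : L -> nat) (N : nat) : set L :=
  [set l | (rank l < N)%N].

(* The p-th power ||v||_p^p of the weighted norm, possibly +oo. *)
Definition normpp (w : L -> R) (p : R) (v : L -> R) : \bar R :=
  \esum_(l in [set: L]) (w l * `|v l| `^ p)%:E.

Definition observation (theta : L -> R) (eps : R) (noise : L -> R) : L -> R :=
  fun l => theta l + eps * noise l.

Definition proj_estimator (Y : L -> R) (m : {fset L}) : L -> R :=
  fun l => Y l * (l \in m)%:R.

Definition Vp (w : L -> R) (p eps : R) (noise : L -> R) (m : {fset L}) : R :=
  eps `^ p * \sum_(l <- m) w l * `|noise l| `^ p.

Definition pco_crit (w : L -> R) (p : R) (pen : {fset L} -> R) (Y : L -> R)
    (m : {fset L}) : R :=
  - (\sum_(l <- m) w l * `|Y l| `^ p) + pen m.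

Definition pco_minimizer (w : L -> R) (p : R) (M : set {fset L})
    (pen : {fset L} -> R) (Y : L -> R) (mhat : {fset L}) : Prop :=
  M mhat /\
  forall m, M m -> pco_crit w p pen Y mhat <= pco_crit w p pen Y m.

End SequenceModel.

(* Main.v *)
(* Since [mhat] minimizes the criterion, [pen mhat - pen m] is at most the
   difference of the sums of [w l * |Y l|^p] over [mhat] and over [m]. After
   this substitution the claim reads coordinate by coordinate. With [a] the
   signal and [b] the noise of a coordinate, it asks for an upper bound of
   [|a + b|^p] when [l] is in [mhat] only, and for a lower bound when [l] is in
   [m] only.
   - Upper bound: write [a + b = t (a / t) + (1 - t) (b / (1 - t))] and use the
     convexity of [x^p]; the choice of [t] that gives [a] the factor
     [1 + beta] gives [b] the factor [Cconv beta p].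
   - Lower bound: if [K |b| <= |a|], factor out [|a|^p] and use
     [C1 p alpha K <= 1 - alpha / 2]; otherwise factor out [|b|^p] and use [C2]. *)
Require Import Defs.
From HB Require Import structures.
From mathcomp Require Import all_boot all_order all_algebra.
From mathcomp Require Import finmap.
From mathcomp Require Import all_classical all_reals all_analysis.
From mathcomp Require Import ring lra.

Set Implicit Arguments.
Unset Strict Implicit.
Unset Printing Implicit Defensive.

Import Order.TTheory GRing.Theory Num.Theory.
Import numFieldNormedType.Exports.

Local Open Scope classical_set_scope.
Local Open Scope ring_scope.

(** * Existence of an admissible constant *)

(** The function under the supremum is continuous and vanishes at 0, while [1 - alpha / 2] is
    positive; a small enough radius [k^-1] therefore works. *)
Lemma exists_C1_le {R : realType} (p alpha : R) :
  1 <= p -> 0 < alpha < 2 -> exists k, 0 < k /\ C1 p alpha k <= 1 - alpha / 2.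
Proof.
move=> p1 /andP[a0 a2].
set eta := 1 - alpha / 2; have eta0 : 0 < eta by rewrite /eta; lra.
have cont1 : {for 1, continuous (fun y : R => y `^ p)}.
  apply: differentiable_continuous; apply/derivable1_diffP.
  by apply: derivable_powR; rewrite in_itv/= ltr01.
have : \forall y \near (1 : R), `|1 `^ p - y `^ p| < eta / 2.
  by move/cvgrPdist_lt: cont1; apply; lra.
rewrite powR1 => -[r /= r0 near1].
(* [1/2] makes [1 + x] positive and gives [|x|^p <= |x|]; [r / 2] puts [1 + x] strictly inside the
   continuity ball; [eta / 4] gives [alpha |x|^p <= 2 |x| <= eta / 2]. *)
pose delta := Num.min (2^-1) (Num.min (r / 2) (eta / 4)).
have delta0 : 0 < delta by rewrite /delta !lt_min; apply/and3P; split; lra.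
exists delta^-1; split; first by rewrite invr_gt0.
apply: ge_sup; first by eexists; exists 0 => //=; rewrite normr0 invrK ltW.
move=> _ [x /= + <-]; rewrite invrK /delta !le_min => /and3P[x2 xr xeta].
have x1p : `|x| `^ p <= `|x|.
  have [->|x0] := eqVneq x 0; first by rewrite normr0 powR0//; lra.
  by apply: ge1r_powR => //; rewrite normr_gt0 x0/=; lra.
have px := powR_ge0 `|x| p.
have := near1 `|1 + x|.
rewrite /ball_/= (@ger0_norm _ (1 + x)); last by move: x2; rewrite ler_norml => /andP[]; lra.
have -> : 1 - (1 + x) = - x by ring.
rewrite normrN => /(_ ltac:(lra)).
rewrite ltr_norml => /andP[lo hi].
have ap : alpha * `|x| `^ p <= 2 * `|x| `^ p by apply: ler_wpM2r => //; lra.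
have ap0 : 0 <= alpha * `|x| `^ p by rewrite mulr_ge0// ltW.
rewrite ler_norml; apply/andP; split; lra.
Qed.

(** * Upper and lower bounds for one coordinate *)

Lemma powRD_le {R : realType} (p beta a b : R) : 1 < p -> 0 < beta ->
  `|a + b| `^ p <= (1 + beta) * `|a| `^ p + Cconv beta p * `|b| `^ p.
Proof.
move=> p1 beta0; have q0 : 0 < p - 1 by lra.
have b1 : 0 <= 1 + beta by lra.
(* This [t] solves [t^(1-p) = 1 + beta]; then [(1-t)^(1-p)] is [Cconv beta p] by definition. *)
set t := (1 + beta) `^ (- (p - 1)^-1).
have t0 : 0 < t by apply: powR_gt0; lra.
have t1 : t < 1.
  rewrite /t powRN invf_lt1 ?powR_gt0//; last lra.
  have : 1 `^ (p - 1)^-1 < (1 + beta) `^ (p - 1)^-1.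
    by apply: gt0_ltr_powR; rewrite ?invr_gt0 ?nnegrE//; lra.
  by rewrite powR1.
have s0 : 0 < 1 - t by lra.
have tE : t `^ (- (p - 1)) = 1 + beta.
  by rewrite -powRrM mulrNN mulVf ?gt_eqF// powRr1.
have scale s (c : R) : 0 < s -> s * (`|c| / s) `^ p = s `^ (- (p - 1)) * `|c| `^ p.
  move=> s_gt0; rewrite powRM ?invr_ge0 ?(ltW s_gt0)// -powR_inv1 ?ltW//.
  rewrite -powRrM mulN1r -{1}[s]powRr1 ?ltW// mulrCA mulrC -powRD; last first.
    by rewrite (gt_eqF s_gt0) implybT.
  by congr (_ `^ _ * _); ring.
rewrite -tE -[Cconv beta p]/((1 - t) `^ (- (p - 1))) -!scale//.
have := @convex_powR R p (ltW p1) (Itv01 (ltW t0) (ltW t1)) (`|a| / t) (`|b| / (1 - t)).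
rewrite !inE/= !in_itv/= !andbT !divr_ge0 ?(ltW t0) ?(ltW s0)// => /(_ isT isT).
apply: le_trans.
change (`|a + b| `^ p <= (t * (`|a| / t) + (1 - t) * (`|b| / (1 - t))) `^ p).
rewrite ![_ * (_ / _)]mulrC !divfK ?gt_eqF//.
by apply: ge0_ler_powR; rewrite ?nnegrE ?addr_ge0//; [lra|exact: ler_normD].
Qed.

(** [sup] dominates its set only if that set is bounded above; the triangle inequality supplies a
    crude bound. *)
Lemma le_C2 {R : realType} (p alpha K x : R) : 0 <= p -> `|x| <= K^-1 ->
  `| `|1 + x| `^ p - alpha - `|x| `^ p | <= C2 p alpha K.
Proof.
move=> p0 xK; apply: ub_le_sup; last by exists x.
exists ((1 + K^-1) `^ p + `|alpha| + K^-1 `^ p) => _ [y /= yK <-].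
have K0 : 0 <= K^-1 := le_trans (normr_ge0 _) yK.
rewrite (le_trans (ler_normB _ _))// lerD ?(le_trans (ler_normB _ _)) ?lerD//.
- rewrite ger0_norm ?powR_ge0// ge0_ler_powR ?nnegrE ?addr_ge0//.
  by rewrite (le_trans (ler_normD _ _))// normr1 lerD2l.
- by rewrite ger0_norm ?powR_ge0// ge0_ler_powR ?nnegrE.
Qed.

Lemma le_C1 {R : realType} (p alpha K x : R) : 0 <= p -> `|x| <= K^-1 ->
  `| `|1 + x| `^ p - 1 - alpha * `|x| `^ p | <= C1 p alpha K.
Proof.
move=> p0 xK; apply: ub_le_sup; last by exists x.
exists ((1 + K^-1) `^ p + 1 + `|alpha| * K^-1 `^ p) => _ [y /= yK <-].
have K0 : 0 <= K^-1 := le_trans (normr_ge0 _) yK.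
rewrite (le_trans (ler_normB _ _))// lerD ?(le_trans (ler_normB _ _)) ?lerD//.
- rewrite ger0_norm ?powR_ge0// ge0_ler_powR ?nnegrE ?addr_ge0//.
  by rewrite (le_trans (ler_normD _ _))// normr1 lerD2l.
- by rewrite normr1.
- rewrite normrM ler_wpM2l// ger0_norm ?powR_ge0// ge0_ler_powR ?nnegrE//.
Qed.

(** [C1] at [K] governs [|b/a| <= 1/K], and [C2] at [K^-1] governs [|a/b| <= K], so the two cases
    are exhaustive. *)
Lemma powRD_ge {R : realType} (p alpha K a b : R) :
  1 <= p -> alpha <= 2 -> 0 < K -> C1 p alpha K <= 1 - alpha / 2 ->
  alpha / 2 * `|a| `^ p + (1 + alpha) * `|b| `^ p <=
  `|a + b| `^ p + (1 + C2 p alpha K^-1) * `|b| `^ p.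
Proof.
move=> p1 alpha2 K0 C1K; have p0 : 0 <= p by lra.
have C20 : 0 <= C2 p alpha K^-1.
  by apply: (le_trans (normr_ge0 _) (le_C2 _ p0 (x := 0) _)); rewrite normr0 invrK ltW.
have scale u v : u != 0 -> `|u + v| `^ p = `|u| `^ p * `|1 + v / u| `^ p.
  by move=> u0; rewrite -powRM// -normrM mulrDr mulr1 mulrCA divff// mulr1.
have ratio u v : u != 0 -> `|v| `^ p = `|u| `^ p * `|v / u| `^ p.
  by move=> u0; rewrite -powRM// -normrM mulrCA divff// mulr1.
have [abK|] := leP (K * `|b|) `|a|.
  have [a0|a0] := eqVneq a 0.
    have -> : b = 0.
      by apply/eqP; rewrite -normr_le0; move: abK; rewrite a0 normr0 pmulr_rle0.
    rewrite a0 addr0 normr0 powR0; [lra|lra].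
  have xK : `|b / a| <= K^-1.
    by rewrite normrM normfV ler_pdivrMr ?normr_gt0// ler_pdivlMl.
  have := le_C1 alpha p0 xK.
  rewrite (scale a b)// (ratio a b)//.
  rewrite ler_norml => /andP[lo _].
  set X := `|a| `^ p; set y := `|b / a| `^ p; set z := `|1 + b / a| `^ p.
  have X0 : 0 <= X := powR_ge0 _ _.
  have y0 : 0 <= y := powR_ge0 _ _.
  (* This accounts for [alpha |b|^p]; the remaining [|b|^p] is paid by the 1 in [1 + C2]. *)
  have : X * (alpha / 2 + alpha * y) <= X * z by apply: ler_wpM2l => //; rewrite /y /z; lra.
  have : 0 <= C2 p alpha K^-1 * (X * y) by rewrite !mulr_ge0.
  lra.
move=> abK; have b0 : b != 0.
  apply: contraTneq abK => ->; rewrite normr0 mulr0 -leNgt//.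
have xK : `|a / b| <= K^-1^-1.
  by rewrite invrK normrM normfV ler_pdivrMr ?normr_gt0// ltW.
have := le_C2 alpha p0 xK.
rewrite addrC (addrC a) (scale b a)// (ratio b a)//.
rewrite ler_norml => /andP[lo _].
set X := `|b| `^ p; set y := `|a / b| `^ p; set z := `|1 + a / b| `^ p.
have X0 : 0 <= X := powR_ge0 _ _.
have y0 : 0 <= y := powR_ge0 _ _.
have : X * (alpha + y - C2 p alpha K^-1) <= X * z.
  by apply: ler_wpM2l => //; rewrite /y /z; lra.
(* The bound by [C2] yields a full [|a|^p], of which only the fraction [alpha / 2] is claimed. *)
have : 0 <= (1 - alpha / 2) * (X * y) by rewrite !mulr_ge0//; lra.
lra.
Qed.

(** * From coordinates to norms *)

(* The first inequality in [a] and [b] serves the [l] in [mhat] but not in [m],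
   the second one the [l] in [m] but not in [mhat]. *)
Lemma pco_oracle {R : realType} {L : countType} (p eps M c k : R)
    (theta w noise : L -> R) (Mcol : set {fset L}) (pen : {fset L} -> R)
    (mhat m : {fset L}) :
  p != 0 -> 0 <= eps -> (forall l, 0 <= w l) -> 0 <= c -> 1 <= M ->
  (forall a b : R, `|b| `^ p <=
     M * `|a| `^ p + c * (k * `|b| `^ p - `|a + b| `^ p)) ->
  (forall a b : R, `|a| `^ p <=
     M * `|b| `^ p + c * (`|a + b| `^ p - k * `|b| `^ p)) ->
  let Y := observation theta eps noise in
  let V := Vp w p eps noise in
  pco_minimizer w p Mcol pen Y mhat -> Mcol m ->
  (normpp w p (proj_estimator Y mhat \- theta)%R <=
     M%:E * normpp w p (proj_estimator Y m \- theta)%R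
     + (c * (k * V mhat - pen mhat))%:E - (c * (k * V m - pen m))%:E)%E.
Proof.
move=> p0 eps0 w0 c0 M1 AB1 AB2 Y V [_ /(_ m)]/[apply] crit.
pose loss (m' : {fset L}) l := w l * `|proj_estimator Y m' l - theta l| `^ p.
have loss0 m' l : 0 <= loss m' l by rewrite mulr_ge0// powR_ge0.
(* Outside this finite set both estimators vanish, so their losses there are the same tail of
   [theta]. *)
pose B := (mhat `|` m)%fset.
have normE m' : (m' `<=` B)%fset -> normpp w p (proj_estimator Y m' \- theta)%R =
    ((\sum_(l <- B) loss m' l)%:E
     + \esum_(l in ~` [set` B]) (w l * `|theta l| `^ p)%:E)%E.
  move=> m'B; rewrite /normpp (esumID [set` B]); last first.
    by move=> l _; rewrite lee_fin loss0.
  rewrite !setTI esum_fset//; last by move=> l _; rewrite lee_fin loss0.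
  rewrite fsbig_finite//= set_fsetK sumEFin; congr (_ + _)%E.
  apply: eq_esum => l /= /negP lB; rewrite /proj_estimator.
  by rewrite (negbTE (contra (fsubsetP m'B l) lB)) mulr0 sub0r normrN.
rewrite !normE ?fsubsetUl ?fsubsetUr//.
(* With indicators, the sums over [mhat] and [m] both run over [B] and can be compared term by
   term. *)
pose g l := w l * (k * `|eps * noise l| `^ p - `|Y l| `^ p).
have sumg m' : (m' `<=` B)%fset ->
    k * V m' - \sum_(l <- m') w l * `|Y l| `^ p =
    \sum_(l <- B) g l * (l \in m')%:R.
  move=> m'B; rewrite -(@big_fset_incl _ _ _ _ _ _ _ m'B); last first.
    by move=> l _ /negbTE ->; rewrite mulr0.
  rewrite /V /Vp !mulr_sumr -sumrB big_seq [RHS]big_seq; apply: eq_bigr => l ->.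
  by rewrite mulr1 /g normrM (ger0_norm eps0) powRM//; ring.
have main : \sum_(l <- B) loss mhat l <= M * \sum_(l <- B) loss m l
    + c * (k * V mhat - pen mhat) - c * (k * V m - pen m).
  have : \sum_(l <- B) loss mhat l <= M * \sum_(l <- B) loss m l
      + c * (\sum_(l <- B) g l * (l \in mhat)%:R - \sum_(l <- B) g l * (l \in m)%:R).
    rewrite -sumrB !mulr_sumr -big_split/=; apply: ler_sum => l _.
    rewrite /loss /g /proj_estimator /Y /observation.
    set a := theta l; set b := eps * noise l.
    have ea : a + b - a = b by ring.
    (* If [l] is in both sets or in neither, the two losses agree and [1 <= M] suffices. *)
    case: (l \in mhat); case: (l \in m);
      rewrite ?(mulr0, mulr1, sub0r, subr0, normrN, subrr, addr0) ?ea.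
    - by rewrite ler_peMl// mulr_ge0// powR_ge0.
    - by have := ler_wpM2l (w0 l) (AB1 a b); lra.
    - by have := ler_wpM2l (w0 l) (AB2 a b); lra.
    - by rewrite ler_peMl// mulr_ge0// powR_ge0.
  rewrite -!sumg ?fsubsetUl ?fsubsetUr//.
  (* Minimality of [mhat] trades the sums of [w l * |Y l|^p] for the penalties. *)
  by move: (ler_wpM2l c0 crit); rewrite /pco_crit; lra.
set S := (\esum_(_ in _) _)%E.
have S0 : (0 <= S)%E.
  by apply: esum_ge0 => l _; rewrite lee_fin mulr_ge0// powR_ge0.
have M0 : 0 <= M by lra.
rewrite ge0_muleDr//; last by rewrite lee_fin sumr_ge0.
(* The common tail, possibly infinite, is absorbed thanks to [1 <= M]. *)
have MS : (S <= M%:E * S)%E by rewrite lee_pemull.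
rewrite -EFinM (addeC _ (M%:E * S)%E) -!addeA -!EFinN -!EFinD addeC.
by apply: leeD => //; rewrite lee_fin addrA.
Qed.

(** * The coordinate inequalities with explicit constants *)

Lemma oracle_inequalities_gt1 {R : realType} (p alpha K M a b : R) :
  1 < p -> 0 < alpha < 2 -> 0 < K -> C1 p alpha K <= 1 - alpha / 2 ->
  M = 2 / alpha * (1 + Num.max (Cconv (alpha / 2) p - 1) (C2 p alpha K^-1)) ->
  [/\ 1 <= M,
      `|b| `^ p <=
        M * `|a| `^ p + 2 / alpha * ((1 + alpha) * `|b| `^ p - `|a + b| `^ p) &
      `|a| `^ p <=
        M * `|b| `^ p + 2 / alpha * (`|a + b| `^ p - (1 + alpha) * `|b| `^ p)].
Proof.
move=> p1 /andP[alpha0 alpha2] K0 C1K ->; set mx := Num.max _ _.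
have Ca : 0 < 2 / alpha by rewrite divr_gt0.
have scale (x y : R) : (x <= 2 / alpha * y) = (alpha / 2 * x <= y).
  by rewrite -ler_pdivrMl// invf_div.
(* Abstracting [2 / alpha] keeps it whole when products are reassociated below. *)
move: (2 / alpha) {Ca} scale => s scale.
have mxC : Cconv (alpha / 2) p - 1 <= mx by rewrite /mx le_max lexx.
have mxC2 : C2 p alpha K^-1 <= mx by rewrite /mx le_max lexx orbT.
have C20 : 0 <= C2 p alpha K^-1.
  apply: le_trans (normr_ge0 _) (@le_C2 _ p alpha K^-1 0 _ _); first lra.
  by rewrite normr0 invrK ltW.
have A0 := powR_ge0 `|a| p; have B0 := powR_ge0 `|b| p.
split; rewrite -?mulrA -?mulrDr scale; first lra.
(* The roles are swapped: the noise [b] gets the factor [1 + alpha / 2], which leaves exactly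
   [alpha / 2] of the [(1 + alpha) |b|^p] available. *)
- have := powRD_le b a p1 (ltac:(lra) : 0 < alpha / 2).
  have := ler_wpM2r A0 mxC.
  rewrite (addrC b); lra.
- have := powRD_ge a b (ltW p1) (ltW alpha2) K0 C1K.
  have := ler_wpM2r B0 mxC2.
  lra.
Qed.

(** For [p = 1] the triangle inequality suffices. After clearing the minimum, the first bound uses
    that it is at most [alpha], the second that it is at most 1; the numerator [2 + alpha] leaves
    [|a + b| + |b|] in the second. *)
Lemma oracle_inequalities_1 {R : realType} (alpha a b : R) : 0 < alpha ->
  let c := (Num.min alpha 1)^-1 in let M := (2 + alpha) / Num.min alpha 1 in
  [/\ 1 <= M,
      `|b| <= M * `|a| + c * ((1 + alpha) * `|b| - `|a + b|) &
      `|a| <= M * `|b| + c * (`|a + b| - (1 + alpha) * `|b|)].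
Proof.
move=> alpha0; set m := Num.min alpha 1.
have m_alpha : m <= alpha by rewrite /m ge_min lexx.
have m1 : m <= 1 by rewrite /m ge_min lexx orbT.
have m0 : 0 < m by rewrite /m lt_min alpha0 ltr01.
have scale (x y : R) : (x <= m^-1 * y) = (m * x <= y) by rewrite ler_pdivlMl.
move=> c M; rewrite {}/M {}/c (mulrC (2 + alpha)).
have ab := ler_normD a b.
have ba : `|a| <= `|a + b| + `|b| by rewrite -[X in `|X| <= _](addrK b) ler_normB.
have A0 := normr_ge0 a; have B0 := normr_ge0 b.
split; rewrite -?mulrA -?mulrDr scale; first lra.
- have : m * `|b| <= alpha * `|b| by apply: ler_wpM2r.
  have : 0 <= alpha * `|a| by rewrite mulr_ge0// ltW.
  lra.
- have : m * `|a| <= 1 * `|a| by apply: ler_wpM2r.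
  lra.
Qed.

(** * Choice of the constants and assembly *)

Theorem theorem2p1 (R : realType) :
  (exists K : R -> R -> R, admissible_K K) /\
  forall K : R -> R -> R, admissible_K K ->
  exists M : R -> R -> R,
    (forall p alpha : R, 1 < p -> 0 < alpha < 2 ->
       M p alpha = 2 / alpha *
         (1 + Num.max (Cconv (alpha / 2) p - 1)
                      (C2 p alpha (K p alpha)^-1))) /\
    forall (L : countType) (rank : L -> nat) (N : nat)
      (d : measure_display) (T : measurableType d) (P : probability T R)
      (xi : L -> {RV P >-> R}) (eps p : R) (theta w : L -> R)
      (Mcol : set {fset L}) (pen : {fset L} -> R) (mhat : T -> {fset L}),
    is_enumeration rank ->
    mutually_independent xi ->
    identically_distributed xi ->
    (forall l : L, centered (xi l)) ->
    (forall l : L, subgaussian_tail (xi l)) ->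
    0 < eps <= 1 ->
    1 <= p ->
    (forall l : L, 0 <= w l) ->
    (normpp w p theta < +oo)%E ->
    Mcol !=set0 ->
    (forall m : {fset L}, Mcol m ->
       forall l : L, l \in m -> first_elements rank N l) ->
    (forall m : {fset L}, Mcol m -> 0 <= pen m) ->
    (forall om : T, pco_minimizer w p Mcol pen
       (observation theta eps (fun l => xi l om)) (mhat om)) ->
    forall (om : T) (m : {fset L}), Mcol m ->
      let noise := fun l => xi l om in
      let Y := observation theta eps noise in
      let thetatilde := proj_estimator Y (mhat om) in
      let V := Vp w p eps noise in
      (1 < p ->
        (forall alpha : R, 0 < alpha < 2 ->
          (normpp w p (thetatilde \- theta)%R <=
             (M p alpha)%:E * normpp w p (proj_estimator Y m \- theta)%R
             + (2 / alpha * ((1 + alpha) * V (mhat om) - pen (mhat om)))%:E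
             - (2 / alpha * ((1 + alpha) * V m - pen m))%:E)%E) /\
        (normpp w p (thetatilde \- theta)%R <=
           (M p 1)%:E * normpp w p (proj_estimator Y m \- theta)%R
           + (2 * (2 * V (mhat om) - pen (mhat om)))%:E
           - (2 * (2 * V m - pen m))%:E)%E) /\
      (p = 1 ->
        forall alpha : R, 0 < alpha < 2 ->
          (normpp w p (thetatilde \- theta)%R <=
             (M 1 alpha)%:E * normpp w p (proj_estimator Y m \- theta)%R
             + ((Num.min alpha 1)^-1 *
                  ((1 + alpha) * V (mhat om) - pen (mhat om)))%:E
             - ((Num.min alpha 1)^-1 * ((1 + alpha) * V m - pen m))%:E)%E).
Proof.
split.
  (* The range conditions sit inside [good], so that choice applies to all pairs; outside the range
     the value 0 is a dummy. *)
  pose good (q : R * R) k := 1 <= q.1 -> 0 < q.2 < 2 ->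
    0 < k /\ C1 q.1 q.2 k <= 1 - q.2 / 2.
  have [K KP] : {K : R * R -> R & forall q, good q (K q)}.
    apply: choice => -[p alpha]; rewrite /good /=.
    have [p1|] := boolP (1 <= p); last by exists 0.
    have [a02|] := boolP (0 < alpha < 2); last by exists 0.
    by have [k ?] := exists_C1_le p1 a02; exists k.
  by exists (fun p alpha => K (p, alpha)) => p alpha; exact: (KP (p, alpha)).
move=> K KP.
pose M (p alpha : R) := if p == 1 then (2 + alpha) / Num.min alpha 1 else
  2 / alpha * (1 + Num.max (Cconv (alpha / 2) p - 1) (C2 p alpha (K p alpha)^-1)).
have ME p alpha : 1 < p -> M p alpha = 2 / alpha *
    (1 + Num.max (Cconv (alpha / 2) p - 1) (C2 p alpha (K p alpha)^-1)).
  by move=> p1; rewrite /M gt_eqF.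
exists M; split; first by move=> p alpha p1 _; exact: ME.
move=> L rank N d T P xi eps p theta w Mcol pen mhat _ _ _ _ _ /andP[eps0 _] p_ge1.
move=> w0 _ _ _ _ mhatP om m Mm noise Y thetatilde V.
have p0 : p != 0 by rewrite gt_eqF//; lra.
split=> [p1|p_eq alpha /andP[alpha0 alpha2]]; last first.
  have H a b := oracle_inequalities_1 a b alpha0.
  have ME1 : M 1 alpha = (2 + alpha) / Num.min alpha 1 by rewrite /M eqxx.
  apply: pco_oracle (mhatP om) Mm => //; rewrite ?ME1 ?invr_ge0 ?le_min ?(ltW eps0) ?(ltW alpha0) ?ler01//.
  (* The bound [1 <= M] does not involve [a] and [b]; any pair yields it. *)
  - by have [] := H 0 0.
  - by move=> a b; rewrite p_eq !powRr1//; have [] := H a b.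
  - by move=> a b; rewrite p_eq !powRr1//; have [] := H a b.
have gt1 alpha : 0 < alpha < 2 ->
    (normpp w p (thetatilde \- theta)%R <=
       (M p alpha)%:E * normpp w p (proj_estimator Y m \- theta)%R
       + (2 / alpha * ((1 + alpha) * V (mhat om) - pen (mhat om)))%:E
       - (2 / alpha * ((1 + alpha) * V m - pen m))%:E)%E.
  move=> alpha02; have [K0 C1K] := KP p alpha p_ge1 alpha02.
  have H a b := oracle_inequalities_gt1 a b p1 alpha02 K0 C1K (ME p alpha p1).
  have alpha0 : 0 < alpha by case/andP: alpha02.
  apply: pco_oracle (mhatP om) Mm => //; rewrite ?divr_ge0 ?(ltW eps0) ?(ltW alpha0)//.
  - by have [] := H 0 0.
  - by move=> a b; have [] := H a b.
  - by move=> a b; have [] := H a b.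
split=> //; have := gt1 1; rewrite divr1 -[1 + 1]/2; apply.
by rewrite ltr01 ltr1n.
Qed.
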